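(* For every simplicial complex $\Delta$ on vertex set $[n]=\{1,\dots,n\}$ and every $i>0$, the $\mathbb{N}^n$-graded Hilbert series of the Koszul module $W_i(\Delta)$ is given by $$\sum_{\mathbf{a}\in\mathbb{N}^n}\dim_\Bbbk[W_i(\Delta)]_{\mathbf{a}}\,\mathbf{t}^{\mathbf{a}}=\sum_{\substack{\mathbf{b}\in\mathbb{N}^n\\ \mathbf{b}\text{ square-free}}}\dim_\Bbbk\bigl(\widetilde{H}_{i-1}(\Delta_{\mathbf{b}};\Bbbk)\bigr)\,\frac{\mathbf{t}^{\mathbf{b}}}{\prod_{j\in\operatorname{Supp}(\mathbf{b})}(1-t_j)}.$$
   Context: $\Bbbk$ is a field of characteristic $0$ and $S=\Bbbk[x_1,\dots,x_n]$ with the $\mathbb{N}^n$-grading $\deg x_i=\mathbf{e}_i$ (the $i$-th standard basis vector). A simplicial complex $\Delta$ on vertex set $[n]$ is a collection of subsets (faces) of $[n]$ closed under taking subsets and containing $\emptyset$ and all singletons $\{i\}$. Koszul modules: let $V$ be a $\Bbbk$-vector space with basis $v_1,\dots,v_n$, $\deg v_i=\mathbf{e}_i$, and let $\mathbf{K}_\bullet=\bigwedge^\bullet V\otimes_\Bbbk S$ be the Koszul complex of $x_1,\dots,x_n$, with differential $\partial(v_{j_1}\wedge\cdots\wedge v_{j_i})=\sum_{k}(-1)^{k-1}x_{j_k}\,v_{j_1}\wedge\cdots\widehat{v_{j_k}}\cdots\wedge v_{j_i}$. Let $\mathbf{K}^\Delta_\bullet\subseteq\mathbf{K}_\bullet$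 be the subcomplex whose $i$-th term is the free $S$-module generated by those $v_{j_1}\wedge\cdots\wedge v_{j_i}$ with $\{j_1,\dots,j_i\}\in\Delta$. Then $W_i(\Delta):=H_i(\mathbf{K}^\Delta_\bullet)$, an $\mathbb{N}^n$-graded $S$-module. A multi-index $\mathbf{b}\in\mathbb{N}^n$ is square-free if all its entries are $0$ or $1$; $\operatorname{Supp}(\mathbf{b})=\{j\mid b_j>0\}$; $\mathbf{t}^{\mathbf{a}}=t_1^{a_1}\cdots t_n^{a_n}$. For $\mathbf{b}$ square-free, $\Delta_{\mathbf{b}}=\{\tau\in\Delta\mid\tau\subseteq\operatorname{Supp}(\mathbf{b})\}$. $\widetilde{H}$ denotes reduced simplicial homology. The identity is one of formal power series in $t_1,\dots,t_n$. *)

(* Defs.v *)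
From HB Require Import structures.
From mathcomp Require Import all_boot all_order all_algebra generic_quotient ring_quotient.
From mathcomp Require Import boolp.
From mathcomp Require Import mpoly.

Set Implicit Arguments.
Unset Strict Implicit.
Unset Printing Implicit Defensive.

Import GRing.Theory.
Local Open Scope ring_scope.
Local Open Scope quotient_scope.

Record fps (R : Type) (n : nat) := Fps { fcoef : 'X_{1..n} -> R }.

HB.instance Definition _ (R : Type) (n : nat) := gen_eqMixin (fps R n).
HB.instance Definition _ (R : Type) (n : nat) := gen_choiceMixin (fps R n).

Lemma fpsP (R : Type) (n : nat) (f g : fps R n) : fcoef f =1 fcoef g -> f = g.
Proof. by case: f g => [f] [g] /funext /= ->. Qed.

Section PowerSeries.
Variables (R : comUnitRingType) (n : nat).
Implicit Types f g h : fps R n.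

Definition fps0 : fps R n := Fps (fun _ => 0).
Definition fpsN f : fps R n := Fps (fun a => - fcoef f a).
Definition fpsD f g : fps R n := Fps (fun a => fcoef f a + fcoef g a).

Fact fpsDA : associative fpsD.
Proof. by move=> f g h; apply: fpsP => a /=; rewrite addrA. Qed.
Fact fpsDC : commutative fpsD.
Proof. by move=> f g; apply: fpsP => a /=; rewrite addrC. Qed.
Fact fps0D : left_id fps0 fpsD.
Proof. by move=> f; apply: fpsP => a /=; rewrite add0r. Qed.
Fact fpsND : left_inverse fps0 fpsN fpsD.
Proof. by move=> f; apply: fpsP => a /=; rewrite addNr. Qed.

HB.instance Definition _ :=
  GRing.isZmodule.Build (fps R n) fpsDA fpsDC fps0D fpsND.

Definition fps1 : fps R n := Fps (fun a => (a == 0%MM)%:R).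

(* Cauchy product; every [b <= a] has degree at most that of [a]. *)
Definition fpsM f g : fps R n :=
  Fps (fun a => \sum_(b : 'X_{1..n < (mdeg a).+1} | (b <= a)%MM)
                  fcoef f b * fcoef g (a - b)%MM).

Definition ftrunc d f : {mpoly R[n]} :=
  \sum_(b : 'X_{1..n < d}) fcoef f b *: 'X_[b].

Lemma ftruncE d f a : (mdeg a < d)%N -> (ftrunc d f)@_a = fcoef f a.
Proof. exact: mcoeff_mpoly. Qed.

Lemma mcoeffM_lin (p q : {mpoly R[n]}) a :
  (p * q)@_a = \sum_(b : 'X_{1..n < (mdeg a).+1} | (b <= a)%MM) p@_b * q@_(a - b).
Proof. by apply: mcoeff_poly_mul_lin. Qed.

Lemma fcoefM_mpoly f g a (p q : {mpoly R[n]}) :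
  (forall b, (mdeg b <= mdeg a)%N -> p@_b = fcoef f b) ->
  (forall b, (mdeg b <= mdeg a)%N -> q@_b = fcoef g b) ->
  fcoef (fpsM f g) a = (p * q)@_a.
Proof.
move=> pf qg; rewrite mcoeffM_lin /=; apply: eq_bigr => b _.
rewrite pf ?qg //; first exact: mdegB.
by rewrite -ltnS; apply: bmdeg.
Qed.

Lemma fcoefM_trunc d f g a : (mdeg a < d)%N ->
  fcoef (fpsM f g) a = (ftrunc d f * ftrunc d g)@_a.
Proof.
by move=> ad; apply: fcoefM_mpoly => b ba; rewrite ftruncE // (leq_ltn_trans ba).
Qed.

Fact fpsMA : associative fpsM.
Proof.
move=> f g h; apply: fpsP => a; pose d := (mdeg a).+1.
rewrite (@fcoefM_mpoly _ _ _ (ftrunc d f) (ftrunc d g * ftrunc d h)).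
- rewrite (@fcoefM_mpoly _ _ _ (ftrunc d f * ftrunc d g) (ftrunc d h)) ?mulrA //.
  + by move=> b ba; rewrite (@fcoefM_trunc d).
  + by move=> b ba; rewrite ftruncE.
- by move=> b ba; rewrite ftruncE.
- by move=> b ba; rewrite (@fcoefM_trunc d).
Qed.

Fact fpsMC : commutative fpsM.
Proof.
by move=> f g; apply: fpsP => a; rewrite !(@fcoefM_trunc (mdeg a).+1) // mulrC.
Qed.

Fact fps1M : left_id fps1 fpsM.
Proof.
move=> f; apply: fpsP => a.
rewrite (@fcoefM_mpoly _ _ _ 1 (ftrunc (mdeg a).+1 f)) => [|b _|b ba].
- by rewrite mul1r ftruncE.
- by rewrite mcoeff1.
- by rewrite ftruncE.
Qed.

Fact fpsMDl : left_distributive fpsM fpsD.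
Proof.
move=> f g h; apply: fpsP => a /=; rewrite -big_split /=.
by apply: eq_bigr => b _; rewrite mulrDl.
Qed.

Fact fps1_neq0 : fps1 != 0.
Proof.
apply/eqP => /(congr1 (fun f => fcoef f 0%MM)) /= /eqP.
by rewrite eqxx (oner_eq0 R).
Qed.

HB.instance Definition _ := GRing.Zmodule_isComNzRing.Build (fps R n)
  fpsMA fpsMC fps1M fpsMDl fps1_neq0.

Lemma fcoefD f g a : fcoef (f + g) a = fcoef f a + fcoef g a.
Proof. by []. Qed.
Lemma fcoefN f a : fcoef (- f) a = - fcoef f a.
Proof. by []. Qed.
Lemma fcoefB f g a : fcoef (f - g) a = fcoef f a - fcoef g a.
Proof. by []. Qed.
Lemma fcoef0 a : fcoef (0 : fps R n) a = 0.
Proof. by []. Qed.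
Lemma fcoef1 a : fcoef (1 : fps R n) a = (a == 0%MM)%:R.
Proof. by []. Qed.
Lemma fcoefM f g a :
  fcoef (f * g) a = \sum_(b : 'X_{1..n < (mdeg a).+1} | (b <= a)%MM)
                      fcoef f b * fcoef g (a - b)%MM.
Proof. by []. Qed.
Lemma fcoef_sum (I : Type) (r : seq I) (P : pred I) (F : I -> fps R n) a :
  fcoef (\sum_(i <- r | P i) F i) a = \sum_(i <- r | P i) fcoef (F i) a.
Proof. by apply: (big_morph (fun f => fcoef f a)). Qed.

Lemma fcoefM0 f g : fcoef (f * g) 0%MM = fcoef f 0%MM * fcoef g 0%MM.
Proof.
by rewrite [LHS](@fcoefM_trunc 1) ?mdeg0 // rmorphM /= !ftruncE ?mdeg0.
Qed.

Definition fpsC (c : R) : fps R n := Fps (fun a => c * (a == 0%MM)%:R).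

Lemma fcoefX_lt f k a : fcoef f 0%MM = 0 -> (mdeg a < k)%N -> fcoef (f ^+ k) a = 0.
Proof.
move=> f0; elim: k a => [//|k IHk] a ak; rewrite exprS fcoefM big1 // => b ba.
have [->|b0] := eqVneq (bmnm b) 0%MM; first by rewrite f0 mul0r.
rewrite IHk ?mulr0 //.
have b_gt0 : (0 < mdeg b)%N by rewrite lt0n mdeg_eq0.
have da : mdeg a = (mdeg (a - b) + mdeg b)%N by rewrite -mdegD submK.
apply: leq_trans (_ : (mdeg (a - b)).+1 <= mdeg a)%N _; last by [].
by rewrite [X in (_ <= X)%N]da -addn1 leq_add2l.
Qed.

(* A series is invertible iff its constant term [c] is; then with *)
(* [u = 1 - c^-1 f] its inverse is [c^-1 (1 + u + u^2 + ...)], and [u^k] does *)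
(* not contribute to the coefficient of [t^a] when [k > |a|]. *)
Definition fps_unit : pred (fps R n) := fun f => fcoef f 0%MM \is a GRing.unit.

Definition fps_inv f : fps R n :=
  if fps_unit f then
    let c := fpsC (fcoef f 0%MM)^-1 in
    c * Fps (fun a => \sum_(k < (mdeg a).+1) fcoef ((1 - c * f) ^+ k) a)
  else f.

Lemma fps_geomP f : fcoef f 0%MM = 0 ->
  (1 - f) * Fps (fun a => \sum_(k < (mdeg a).+1) fcoef (f ^+ k) a) = 1.
Proof.
move=> f0; apply: fpsP => a; set g := Fps _; set d := mdeg a.
pose s := \sum_(k < d.+1) f ^+ k.
have gs b : (mdeg b <= d)%N -> fcoef g b = fcoef s b.
  move=> bd; rewrite /s fcoef_sum /= -!(big_mkord xpredT (fun k => fcoef (f ^+ k) b)).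
  rewrite [RHS](big_cat_nat _ (n := (mdeg b).+1)) //=.
  rewrite [X in _ = _ + X]big_nat_cond [X in _ = _ + X]big1 ?addr0 //.
  by move=> k /andP[/andP[bk _] _]; apply: fcoefX_lt.
have -> : fcoef ((1 - f) * g) a = fcoef ((1 - f) * s) a.
  by rewrite !fcoefM; apply: eq_bigr => b _; rewrite gs // mdegB.
by rewrite /s -[1 - f]opprB mulNr -subrX1 opprB fcoefB fcoefX_lt // subr0.
Qed.

Lemma fcoefC0 c : fcoef (fpsC c) 0%MM = c.
Proof. by rewrite /= eqxx mulr1. Qed.

Fact fps_mulVr : {in fps_unit, left_inverse 1 fps_inv *%R}.
Proof.
move=> f f_unit; rewrite /fps_inv ifT //; set c := fpsC _.
rewrite mulrC mulrA [f * c]mulrC -[X in X * Fps _](subKr 1); apply: fps_geomP.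
by rewrite fcoefB fcoefM0 fcoefC0 fcoef1 eqxx mulVr ?subrr.
Qed.

Fact fps_unitP f g : g * f = 1 -> fps_unit f.
Proof.
move=> /(congr1 (fun h => fcoef h 0%MM)); rewrite fcoefM0 fcoef1 eqxx => gf.
by apply/unitrP; exists (fcoef g 0%MM); rewrite gf mulrC gf.
Qed.

Fact fps_inv_out : {in [predC fps_unit], fps_inv =1 id}.
Proof. by move=> f /negbTE f_unit; rewrite /fps_inv [fps_unit f]f_unit. Qed.

HB.instance Definition _ := GRing.ComNzRing_hasMulInverse.Build (fps R n)
  fps_mulVr fps_unitP fps_inv_out.

Definition tvar (j : 'I_n) : fps R n := Fps (fun a => (a == U_(j)%MM)%:R).

Definition tmon (b : 'X_{1..n}) : fps R n := \prod_(j < n) tvar j ^+ b j.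

(* In particular the denominators [\prod_(j in B) (1 - tvar j)] are units. *)
Lemma unit_1subtvar j : 1 - tvar j \is a GRing.unit.
Proof.
rewrite unfold_in /= /fps_unit fcoefB fcoef1 /= eqxx.
by rewrite eq_sym -mdeg_eq0 mdeg1 subr0 unitr1.
Qed.

End PowerSeries.

Section Dimension.
Variables (k : fieldType) (V : lmodType k).

Definition is_basis (U : V -> Prop) (d : nat) (e : 'I_d -> V) : Prop :=
  [/\ forall i, U (e i),
      forall c : 'I_d -> k, \sum_i c i *: e i = 0 -> forall i, c i = 0 &
      forall u, U u -> exists c : 'I_d -> k, u = \sum_i c i *: e i].

(* Meaningful for finite-dimensional [U] only (the value is otherwise 0), as
   are the homogeneous pieces and the reduced homology it is used for below. *)
Definition dimk (U : V -> Prop) : nat :=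
  if pselect (exists d, exists e : 'I_d -> V, is_basis U e) is left ex
  then projT1 (cid ex) else 0%N.

Lemma basis_leq U d d' (e : 'I_d -> V) (e' : 'I_d' -> V) :
  is_basis U e -> is_basis U e' -> (d <= d')%N.
Proof.
move=> [Ue free_e gen_e] [Ue' free_e' gen_e'].
have /choice [A eA] i := gen_e' _ (Ue i).
have /choice [B eB] i := gen_e _ (Ue' i).
pose mA := \matrix_(i, j) A i j; pose mB := \matrix_(i, j) B i j.
apply: (@mulmx1_min _ _ _ mA mB); apply/matrixP => i l.
rewrite !mxE; apply/eqP; rewrite -subr_eq0; apply/eqP.
pose c l := \sum_j mA i j * mB j l - (i == l)%:R.
apply: (free_e c) => {l}; rewrite /c.
under eq_bigr do rewrite scalerBl scaler_suml.
rewrite sumrB exchange_big /=.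
have -> : \sum_l (i == l)%:R *: e l = e i.
  rewrite (bigD1 i) //= eqxx scale1r big1 ?addr0 // => l.
  by rewrite eq_sym => /negbTE ->; rewrite scale0r.
rewrite [X in _ - X]eA -sumrB big1 // => j _.
rewrite [X in _ - _ *: X]eB scaler_sumr -sumrB big1 // => l _.
by rewrite !mxE scalerA subrr.
Qed.

Lemma dimk_eq U d (e : 'I_d -> V) : is_basis U e -> dimk U = d.
Proof.
rewrite /dimk => Ue; case: pselect => [ex|[]]; last by exists d, e.
case: (cid ex) => d' /= [e' Ue']; apply/eqP.
by rewrite eqn_leq (basis_leq Ue' Ue) (basis_leq Ue Ue').
Qed.

End Dimension.

Section QuotientModule.
Variables (R : nzRingType) (M : lmodType R) (N : submodClosed M).

(* [submodClosed] does not inherit from the [zmodClosed] that quotients need. *)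
Definition submod_pred : {pred M} := fun x => x \in N.

Fact submod_pred_zmod : zmod_closed submod_pred.
Proof. exact: GRing.submod_closedB (submodClosedP N). Qed.
HB.instance Definition _ := GRing.isZmodClosed.Build M submod_pred submod_pred_zmod.

Definition lquot : Type := {ideal_quot submod_pred}.

HB.instance Definition _ := EqQuotient.on lquot.
HB.instance Definition _ := ZmodQuotient.on lquot.

Lemma lquot_eq (x y : M) : (\pi_lquot x = \pi_lquot y) <-> (x - y \in N).
Proof.
have -> : (x - y \in N) = (x - y \in submod_pred) by [].
by rewrite Quotient.idealrBE; split => /eqP.
Qed.

Definition lquot_scale (a : R) : lquot -> lquot := lift_op1 lquot ( *:%R a).

Lemma pi_lquot_scale a (x : M) : \pi_lquot (a *: x) = lquot_scale a (\pi x).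
Proof.
rewrite /lquot_scale; unlock; apply/lquot_eq; rewrite -scalerBr.
by apply/rpredZ/lquot_eq; rewrite reprK.
Qed.

Fact lquot_scaleA a b (v : lquot) :
  lquot_scale a (lquot_scale b v) = lquot_scale (a * b) v.
Proof. by rewrite -[v]reprK -!pi_lquot_scale scalerA. Qed.
Fact lquot_scale1 : left_id 1 lquot_scale.
Proof. by move=> v; rewrite -[v]reprK -pi_lquot_scale scale1r. Qed.
Fact lquot_scaleDr : right_distributive lquot_scale +%R.
Proof.
move=> a u v; rewrite -[u]reprK -[v]reprK -raddfD -!pi_lquot_scale.
by rewrite scalerDr raddfD.
Qed.
Fact lquot_scaleDl v : {morph lquot_scale^~ v : a b / a + b}.
Proof.
by move=> a b; rewrite -[v]reprK -!pi_lquot_scale scalerDl raddfD.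
Qed.

HB.instance Definition _ := GRing.Zmodule_isLmodule.Build R lquot
  lquot_scaleA lquot_scale1 lquot_scaleDr lquot_scaleDl.

End QuotientModule.

Section RestrictScalars.
Variables (k : nzRingType) (A : lalgType k) (M : lmodType A).

Definition restrict_scalars : Type := M.

HB.instance Definition _ := GRing.Zmodule.on restrict_scalars.

Definition restr_scale (c : k) (v : restrict_scalars) : restrict_scalars :=
  (c%:A : A) *: (v : M).

Fact restr_scaleA c d v : restr_scale c (restr_scale d v) = restr_scale (c * d) v.
Proof. by rewrite /restr_scale scalerA -scalerAl mul1r scalerA. Qed.
Fact restr_scale1 : left_id 1 restr_scale.
Proof. by move=> v; rewrite /restr_scale !scale1r. Qed.
Fact restr_scaleDr : right_distributive restr_scale +%R.
Proof. by move=> c u v; apply: scalerDr. Qed.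
Fact restr_scaleDl v : {morph restr_scale^~ v : c d / c + d}.
Proof. by move=> c d; rewrite /restr_scale !scalerDl. Qed.

HB.instance Definition _ := GRing.Zmodule_isLmodule.Build k restrict_scalars
  restr_scaleA restr_scale1 restr_scaleDr restr_scaleDl.

End RestrictScalars.

Definition simplicial_complex n (Delta : {set {set 'I_n}}) : Prop :=
  [/\ set0 \in Delta,
      forall j, [set j] \in Delta &
      forall sigma tau : {set 'I_n},
        sigma \in Delta -> tau \subset sigma -> tau \in Delta].

Definition restrict_complex n (Delta : {set {set 'I_n}}) (B : {set 'I_n}) :=
  [set tau in Delta | tau \subset B].

Section Homology.
Variables (R : comNzRingType) (n : nat) (x : 'I_n -> R).
Implicit Types (Delta : {set {set 'I_n}}) (J : {set 'I_n}) (i : nat).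

(* The exterior algebra of the free [R]-module on [v_1, ..., v_n]: the *)
(* coordinate at [J = {j_1 < ... < j_i}] is the coefficient of the wedge *)
(* [v_J] of [v_(j_1), ..., v_(j_i)] in this order. *)
Definition exterior : Type := {ffun {set 'I_n} -> R^o}.

HB.instance Definition _ := GRing.Lmodule.on exterior.

Definition wedge J : exterior := [ffun I => (I == J)%:R].

(* [j = j_k] is preceded by [k - 1] elements of [J]. Weights [x_j] give the *)
(* Koszul differential, and weights [1] the simplicial boundary. *)
Definition wedge_bdry J : exterior :=
  \sum_(j in J) ((-1) ^+ #|[set l in J | (l < j)%N]| * x j) *: wedge (J :\ j).

Definition bdry (f : exterior) : exterior := \sum_J (f J : R) *: wedge_bdry J.

Fact bdry_is_linear : linear bdry.
Proof.
move=> a f g; rewrite /bdry scaler_sumr -big_split /=.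
by apply: eq_bigr => J _; rewrite !ffunE scalerDl scalerA.
Qed.
HB.instance Definition _ := GRing.isLinear.Build R exterior exterior *:%R bdry bdry_is_linear.

Lemma bdry_wedge J : bdry (wedge J) = wedge_bdry J.
Proof.
rewrite /bdry (bigD1 J) //= ffunE eqxx scale1r big1 ?addr0 // => I IJ.
by rewrite ffunE (negbTE IJ) scale0r.
Qed.

Lemma bdry_wedge_bdry J : bdry (wedge_bdry J) = 0.
Proof.
pose s (j : 'I_n) := (-1) ^+ #|[set l in J | (l < j)%N]| * x j.
have sD (j l : 'I_n) : j \in J ->
    (-1) ^+ #|[set h in J :\ j | (h < l)%N]| * x l
    = (if (j < l)%N then - s l else s l).
  move=> jJ; rewrite /s; case: ifP => jl; last first.
    congr ((-1) ^+ #|pred_of_set _| * _); apply/setP => h; rewrite !inE.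
    by case: eqVneq => //= ->; rewrite jl andbF.
  rewrite (cardsD1 j [set h in J | (h < l)%N]) inE jJ jl add1n exprS mulN1r mulNr opprK.
  by congr ((-1) ^+ #|pred_of_set _| * _); apply/setP => h; rewrite !inE andbA.
pose F j l := (s j * s l) *: wedge (J :\ j :\ l).
have -> : bdry (wedge_bdry J) =
    \sum_(j in J) \sum_(l in J | l != j) (if (j < l)%N then - F j l else F j l).
  rewrite linear_sum /=; apply: eq_bigr => j jJ.
  rewrite linearZ /= bdry_wedge scaler_sumr.
  apply: eq_big => [l|l _]; first by rewrite in_setD1 andbC.
  by rewrite sD // /F /s; case: ifP => _; rewrite scalerA ?mulrN ?scaleNr.
pose P (j l : 'I_n) := [&& j \in J, l \in J & (l < j)%N].
transitivity (\sum_j \sum_(l | P j l) F j l - \sum_j \sum_(l | P l j) F j l).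
  rewrite -sumrB big_mkcond /=; apply: eq_bigr => j _; case: ifP => jJ; last first.
    by rewrite !big_pred0 ?subr0 // => l; rewrite /P jJ ?andbF.
  rewrite (bigID (fun l : 'I_n => (l < j)%N)) /= -sumrN; congr (_ + _).
    apply: eq_big => [l|l /andP[_ lj]]; last by rewrite ltnNge ltnW.
    by rewrite /P jJ -andbA [l != j]neq_ltn; case: ltngtP; rewrite ?andbF.
  apply: eq_big => [l|l /andP[/andP[_ lj]]]; last first.
    by rewrite -leqNgt leq_eqVlt eq_sym (negbTE (lj : l != j :> nat)) /= => ->.
  by rewrite /P jJ -andbA [l != j]neq_ltn; case: ltngtP; rewrite ?andbF.
rewrite [X in _ - X](exchange_big_dep xpredT) //=; apply/eqP; rewrite subr_eq0; apply/eqP.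
apply: eq_bigr => j _; apply: eq_bigr => l _.
by rewrite /F mulrC; congr (_ *: wedge _); apply/setP => h; rewrite !inE andbCA.
Qed.

Lemma bdry_bdry f : bdry (bdry f) = 0.
Proof.
have -> : bdry f = \sum_J (f J : R) *: wedge_bdry J by [].
rewrite linear_sum big1 // => J _.
by rewrite linearZ /= bdry_wedge_bdry scaler0.
Qed.

Variable Delta : {set {set 'I_n}}.

(* The span of the [v_J] with [J] a face having [i] elements. *)
Definition chains i : {pred exterior} :=
  fun f => [forall J, (f J != 0) ==> (J \in Delta) && (#|J| == i)].

Lemma chainsP i (f : exterior) :
  reflect (forall J, ~~ ((J \in Delta) && (#|J| == i)) -> f J = 0) (f \in chains i).
Proof.
apply: (iffP forallP) => fP J.
  by move=> JP; apply/eqP; apply: contraNT JP => /(implyP (fP J)).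
by apply/implyP; apply: contraNT => /fP ->.
Qed.

Fact chains_submod i : submod_closed (chains i).
Proof.
split=> [|a f g /chainsP fP /chainsP gP]; apply/chainsP => J JP.
  by rewrite ffunE.
by rewrite !ffunE fP // gP // scaler0 addr0.
Qed.
HB.instance Definition _ i :=
  GRing.isSubmodClosed.Build R exterior (chains i) (chains_submod i).

Definition is_cycle i : {pred exterior} :=
  fun f => (f \in chains i) && (bdry f == 0).

Fact is_cycle_submod i : submod_closed (is_cycle i).
Proof.
split=> [|a f g /andP[fi /eqP f0] /andP[gi /eqP g0]]; apply/andP; split.
- exact: rpred0.
- by rewrite linear0.
- by rewrite rpredD // rpredZ.
- by rewrite linearP /= f0 g0 scaler0 addr0.
Qed.
HB.instance Definition _ i :=
  GRing.isSubmodClosed.Build R exterior (is_cycle i) (is_cycle_submod i).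

Record cycles i := Cycle { cycle_val :> exterior; _ : cycle_val \in is_cycle i }.
HB.instance Definition _ i := [isSub for @cycle_val i].
HB.instance Definition _ i := [Choice of cycles i by <:].
HB.instance Definition _ i := [SubChoice_isSubLmodule of cycles i by <:].

Definition boundaries i : {pred cycles i} :=
  fun z => `[< exists2 f, f \in chains i.+1 & val z = bdry f >].

Fact boundaries_submod i : submod_closed (@boundaries i).
Proof.
split=> [|a y z /asboolP[f fP yf] /asboolP[g gP zg]]; apply/asboolP.
  by exists 0; [exact: rpred0 | rewrite linear0 raddf0].
exists (a *: f + g); first by rewrite rpredD // rpredZ.
by rewrite !linearP /= -yf -zg.
Qed.
HB.instance Definition _ i :=
  GRing.isSubmodClosed.Build R (cycles i) (@boundaries i) (@boundaries_submod i).

(* The [i] counts the elements of the faces, not their dimension. *)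
Definition homology i : lmodType R := lquot (@boundaries i).

End Homology.

Definition reduced_homology (k : fieldType) n p (Delta : {set {set 'I_n}}) : lmodType k :=
  homology (fun _ : 'I_n => 1 : k) Delta p.+1.

Section KoszulModule.
Variables (k : fieldType) (n : nat) (Delta : {set {set 'I_n}}) (i : nat).

Definition koszul_module : lmodType {mpoly k[n]} :=
  homology (fun j : 'I_n => 'X_j : {mpoly k[n]}) Delta i.

(* [v_J] has degree [mesym1 J], the sum of the [e_j] for [j] in [J]. *)
Definition koszul_homogeneous (a : 'X_{1..n}) (f : exterior {mpoly k[n]} n) : Prop :=
  forall J m, m \in msupp (f J) -> (m + mesym1 J)%MM = a.

Definition koszul_piece (a : 'X_{1..n}) (w : restrict_scalars koszul_module) : Prop :=
  exists2 z : cycles (fun j : 'I_n => 'X_j : {mpoly k[n]}) Delta i,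
    koszul_homogeneous a (val z) & w = \pi z.

Definition koszul_hilbert_series : fps int n :=
  Fps (fun a => (dimk (koszul_piece a))%:R).

End KoszulModule.

Definition squarefree n (b : 'X_{1..n}) : bool := [forall j, (b j <= 1)%N].

Definition Supp n (b : 'X_{1..n}) : {set 'I_n} := [set j | (0 < b j)%N].

(* Main.v *)
Require Import Defs.
From HB Require Import structures.
From mathcomp Require Import all_boot all_order all_algebra generic_quotient.
From mathcomp Require Import boolp mpoly.

(** The complex [K^Delta] is graded by multidegree, and its strand of degree
    [a] has for basis the [x^(a - e_J) v_J], one for each face [J] of [Delta]
    contained in the support of [a] (here [e_J] is the sum of the [e_j] for
    [j] in [J]). Multiplying a coefficient by [x_j] while [v_J] becomes
    [v_(J - j)] moves one such basis element to another, up to sign. The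
    monomials can thus be forgotten: the strand is the augmented chain complex
    of the restriction of [Delta] to [Supp a], and [W_i(Delta)_a] is its reduced
    homology in dimension [i - 1] ([dimk_koszul_piece]). The isomorphism is
    carried by [to_strand], which inserts the monomials, and by its inverse
    [of_strand], which reads the coefficients of degree [a]. The latter commutes
    with the boundary on every Koszul chain, homogeneous or not. This matters
    because a class of degree [a] is zero as soon as its cycle bounds some
    chain: [of_strand] turns that chain into a simplicial one.

    In particular the dimension depends on [Supp a] only. On the other side,
    for a square-free [b] the fraction [t^b / prod (1 - t_j)] is the sum of the
    [t^a] for [a] of support [Supp b] ([tmon_div_squarefree]), so that a
    combination of these fractions has for coefficient of [t^a] the one of
    the only square-free [b] with the support of [a] ([fcoef_sum_squarefree]). *)

Set Implicit Arguments.
Unset Strict Implicit.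
Unset Printing Implicit Defensive.

Import GRing.Theory.
Local Open Scope ring_scope.
Local Open Scope quotient_scope.

(** * Monomials of a given support *)

Lemma mcoeffXM (R : comUnitRingType) n (p : {mpoly R[n]}) (j : 'I_n) a :
  ('X_j * p)@_a = if (0 < a j)%N then p@_(a - U_(j)) else 0.
Proof.
case: ifP => aj.
  have aE : a = (U_(j) + (a - U_(j)))%MM by rewrite addmC submK // lep1mP -lt0n.
  by rewrite [in LHS]aE mulrC mcoeffMX.
rewrite mcoeffM_lin big1 // => b ba; rewrite mcoeffX.
case: eqP => [bE|_]; last by rewrite mul0r.
by move/mnm_lepP/(_ j): ba; rewrite -bE mnm1E eqxx aj.
Qed.

Section Series.
Variables (R : comUnitRingType) (n : nat).

Lemma fcoef_tvarM (f : fps R n) (j : 'I_n) a :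
  fcoef (tvar R j * f) a = if (0 < a j)%N then fcoef f (a - U_(j))%MM else 0.
Proof.
rewrite [LHS](@fcoefM_mpoly _ _ _ _ _ 'X_j (ftrunc (mdeg a).+1 f)).
- by rewrite mcoeffXM; case: ifP => // aj; rewrite ftruncE // ltnS mdegB.
- by move=> b _; rewrite mcoeffX eq_sym.
- by move=> b ba; rewrite ftruncE.
Qed.

(** By [supp_seriesE], the expansion of the product over [B] of the
    [t_j / (1 - t_j)]. *)
Definition supp_series (B : {set 'I_n}) : fps R n :=
  Fps (fun a => (Supp a == B)%:R).

Lemma SuppD1 (a : 'X_{1..n}) (j : 'I_n) :
  (0 < a j)%N -> j |: Supp (a - U_(j))%MM = Supp a.
Proof.
move=> aj; apply/setP=> l; rewrite !inE mnmBE mnm1E eq_sym.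
by case: eqVneq => [<-|_]; rewrite ?aj ?subn0.
Qed.

(** Multiplying by [1 - t_j] subtracts, from the monomials of support [j |: B],
    those where the exponent of [t_j] is at least 2; what remains is [t_j] times
    the monomials of support [B]. *)
Lemma supp_seriesU1 (B : {set 'I_n}) j : j \notin B ->
  supp_series (j |: B) * (1 - tvar R j) = tvar R j * supp_series B.
Proof.
move=> jB; apply: fpsP => a; rewrite mulrBr mulr1 mulrC fcoefB !fcoef_tvarM /=.
(* [t^a] appears on neither side unless [t_j] divides it. *)
case: ifP => aj; last first.
  rewrite subr0; case: eqP => // /setP/(_ j).
  by rewrite !inE eqxx aj.
rewrite -(SuppD1 aj); set C := Supp _.
apply/eqP; rewrite subr_eq -natrD; apply/eqP; congr _%:R.
(* Now [C] is the support of [t^a / t_j], which contains [j] iff [a j >= 2]. *)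
have [jC|jC] := boolP (j \in C).
  rewrite (setUidPr _) ?sub1set //.
  by have -> : (C == B) = false by apply: contraNF jB => /eqP <-.
have -> : (C == j |: B) = false by apply: contraNF jC => /eqP ->; rewrite setU11.
rewrite addn0; congr nat_of_bool; apply/eqP/eqP => [|-> //].
by move=> /(congr1 (fun D => D :\ j)); rewrite !setU1K.
Qed.

Lemma supp_series0 : supp_series set0 = 1.
Proof.
apply: fpsP => a; rewrite fcoef1 /=; congr (nat_of_bool _)%:R.
apply/eqP/eqP => [/setP a0|->]; last by apply/setP=> l; rewrite !inE mnm0E.
by apply/mnmP => l; have := a0 l; rewrite !inE mnm0E; case: (a l).
Qed.

Lemma supp_seriesE (B : {set 'I_n}) :
  supp_series B * \prod_(j in B) (1 - tvar R j) = \prod_(j in B) tvar R j.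
Proof.
move En: #|B| => m; elim: m B En => [|m IH] B.
  by move/eqP; rewrite cards_eq0 => /eqP ->; rewrite !big_set0 mulr1 supp_series0.
move=> En; have /card_gt0P[j jB] : (0 < #|B|)%N by rewrite En.
have jBj : j \notin B :\ j by rewrite setD11.
move: En; rewrite -(setD1K jB) cardsU1 jBj add1n => -[En].
by rewrite !big_setU1 //= mulrA supp_seriesU1 // -mulrA IH.
Qed.

Lemma tmon_squarefree (b : 'X_{1..n}) : squarefree b ->
  tmon R b = \prod_(j in Supp b) tvar R j.
Proof.
move=> /forallP sb; rewrite /tmon [RHS]big_mkcond; apply: eq_bigr => j _.
by rewrite inE; case: (b j) (sb j) => [|[|]].
Qed.

Lemma tmon_div_squarefree (b : 'X_{1..n}) : squarefree b ->
  tmon R b / \prod_(j in Supp b) (1 - tvar R j) = supp_series (Supp b).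
Proof.
move=> sb; rewrite tmon_squarefree // -supp_seriesE mulrK //.
by apply: rpred_prod => j _; exact: unit_1subtvar.
Qed.

Lemma Supp_mesym1 (B : {set 'I_n}) : Supp (mesym1 B) = B.
Proof. by apply/setP => j; rewrite inE mnmE lt0b. Qed.

Lemma squarefree_mesym1 (B : {set 'I_n}) : squarefree (mesym1 B).
Proof. by apply/forallP => j; rewrite mnmE leq_b1. Qed.

Lemma squarefree_SuppK (b : 'X_{1..n}) : squarefree b -> mesym1 (Supp b) = b.
Proof.
move=> /forallP sb; apply/mnmP => j; rewrite mnmE inE.
by case: (b j) (sb j) => [|[|]].
Qed.

Lemma fcoef_natM (m : nat) (f : fps R n) a :
  fcoef (m%:R * f) a = m%:R * fcoef f a.
Proof.
rewrite !mulr_natl; elim: m => [|m IH]; first by rewrite !mulr0n.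
by rewrite !mulrS fcoefD IH.
Qed.

(** A given [a] has the same support as exactly one square-free multi-index,
    [mesym1 (Supp a)]. *)
Lemma fcoef_sum_squarefree (D : {set 'I_n} -> nat) a :
  fcoef (\sum_(b : 'X_{1..n < n.+1} | squarefree b)
    (D (Supp b))%:R * (tmon R b / \prod_(j in Supp b) (1 - tvar R j))) a
  = (D (Supp a))%:R.
Proof.
have ltBn : (mdeg (mesym1 (Supp a)) < n.+1)%N.
  by rewrite mdeg_mesym1 ltnS (leq_trans (max_card _)) ?card_ord.
rewrite fcoef_sum; under eq_bigr => b sb do rewrite tmon_div_squarefree // fcoef_natM.
rewrite (bigD1 (BMultinom ltBn)) ?squarefree_mesym1 //=.
rewrite [X in _ + X]big1 ?addr0; first by rewrite Supp_mesym1 eqxx mulr1.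
move=> b /andP[sb nb]; case: eqP => [Sab|_]; last by rewrite mulr0.
by case/eqP: nb; apply: val_inj => /=; rewrite Sab squarefree_SuppK.
Qed.
End Series.

(** * Dimensions *)

(** Bases are transported in both directions, so that the equality also holds
    when there is no finite basis and both sides take the default value. *)
Lemma dimk_inj_image (k : fieldType) (V W : lmodType k) (U : V -> Prop)
    (U' : W -> Prop) (phi : {linear V -> W}) :
  injective phi -> (forall w, U' w <-> exists2 v, U v & w = phi v) ->
  dimk U = dimk U'.
Proof.
move=> phi_inj U'P.
have phiS d (c : 'I_d -> k) (e : 'I_d -> V) :
    \sum_i c i *: phi (e i) = phi (\sum_i c i *: e i).
  by rewrite linear_sum; apply: eq_bigr => i _; rewrite linearZ.
have basisP d (e : 'I_d -> V) : is_basis U e <-> is_basis U' (phi \o e).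
  split=> -[Ue free_e gen_e]; split=> [i|c|u /=].
  - by apply/U'P; exists (e i).
  - by rewrite phiS -(raddf0 phi) => /phi_inj/free_e.
  - by case/U'P => v /gen_e[c ->] ->; exists c; rewrite phiS.
  - by have /U'P[v Uv /phi_inj ->] := Ue i.
  - by move=> e0; apply: free_e; rewrite phiS e0 raddf0.
  - move=> Uu; have [|c] := gen_e (phi u); first by apply/U'P; exists u.
    by rewrite phiS => /phi_inj ->; exists c.
rewrite [LHS]/dimk; case: pselect => [ex|nex].
  by case: (cid ex) => d /= [e /basisP/dimk_eq ->].
rewrite /dimk; case: pselect => // -[d [e' Ue']].
have [U'e' _ _] := Ue'.
have /choice[e eE] i : exists v, e' i = phi v.
  by have /U'P[v _ ->] := U'e' i; exists v.
case: nex; exists d, e; apply/basisP.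
by have -> : phi \o e = e' by apply/funext => i /=.
Qed.

(** * The strand of a given multidegree *)

Section Bdry.
Variables (R : comNzRingType) (n : nat) (x : 'I_n -> R).

(** The sum is kept over pairs [(J, j)] with [I = J - j]: the signs are then the
    same for all weights [x], and the two differentials can be compared term
    by term. *)
Lemma bdryE (f : exterior R n) I :
  bdry x f I = \sum_(J : {set 'I_n}) \sum_(j in J | I == J :\ j)
    (-1) ^+ #|[set l in J | (l < j)%N]| * (x j * f J).
Proof.
rewrite /bdry sum_ffunE; apply: eq_bigr => J _.
rewrite ffunE /wedge_bdry sum_ffunE scaler_sumr [RHS]big_mkcondr /=.
apply: eq_bigr => j _; rewrite !ffunE; case: eqP => _; last by rewrite !scaler0.
by rewrite /GRing.scale /= mulr1 mulrC mulrA.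
Qed.
End Bdry.

Lemma mesym1_setD1 n (J : {set 'I_n}) j :
  j \in J -> mesym1 J = (U_(j) + mesym1 (J :\ j))%MM.
Proof.
move=> jJ; apply/mnmP => l; rewrite !(mnmE, mnmDE, mnm1E) !inE eq_sym.
by case: eqVneq => // ->; rewrite jJ.
Qed.

Section Strand.
Variables (k : fieldType) (n : nat) (Delta : {set {set 'I_n}}) (a : 'X_{1..n}).
Local Notation S := {mpoly k[n]}.
Local Notation B := (Supp a).
Local Notation X := (fun j : 'I_n => 'X_j : S).
Local Notation one := (fun _ : 'I_n => 1 : k).
Local Notation DeltaB := (restrict_complex Delta B).

(** Outside the subsets of [Supp a] the truncated difference [a - mesym1 J] is
    not the exponent of a monomial of the strand, so [to_strand] is meaningful
    on these chains only. *)
Definition supported (c : exterior k n) :=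
  forall J : {set 'I_n}, ~~ (J \subset B) -> c J = 0.

Definition to_strand (c : exterior k n) : exterior S n :=
  [ffun J => c J *: 'X_[a - mesym1 J]].

Definition of_strand (f : exterior S n) : exterior k n :=
  [ffun J : {set 'I_n} => if J \subset B then (f J)@_(a - mesym1 J) else 0].

Lemma mesym1_le (J : {set 'I_n}) : (mesym1 J <= a)%MM = (J \subset B).
Proof.
by apply/mnm_lepP/subsetP => aJ j; have := aJ j; rewrite mnmE inE;
  case: (j \in J) => // ->.
Qed.

Fact to_strand_is_linear c d e :
  to_strand (c *: d + e) = c%:A *: to_strand d + to_strand e.
Proof.
apply/ffunP=> J; rewrite !ffunE scalerDl -scalerA; congr (_ + _).
by rewrite -[RHS]/((c%:A : S) * (d J *: 'X_[_])) mulr_algl.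
Qed.

(** [x_j x^(a - e_J) = x^(a - e_(J - j))] when [j] is in [J] and [J] in
    [Supp a]. *)
Lemma to_strand_bdry c : supported c ->
  to_strand (bdry one c) = bdry X (to_strand c).
Proof.
move=> cB; apply/ffunP => I; rewrite ffunE !bdryE scaler_suml.
apply: eq_bigr => J _; rewrite scaler_suml; apply: eq_bigr => j /andP[jJ /eqP ->].
rewrite ffunE mul1r; have [JB|/cB->] := boolP (J \subset B); last first.
  by rewrite scale0r !mulr0 scale0r.
rewrite -scalerAr -mpolyXD -scalerA; set m := (a - _)%MM; set m' := (U_(_) + _)%MM.
have -> : m' = m.
  apply: (@addIm _ (mesym1 (J :\ j))).
  rewrite /m /m' [(U_(j) + _)%MM]addmC -addmA -mesym1_setD1 //.
  by rewrite !submK ?mesym1_le // (subset_trans (subD1set _ _)).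
rewrite -signr_odd -[in RHS]signr_odd; case: odd.
  by rewrite expr1 scaleN1r mulN1r.
by rewrite scale1r mul1r.
Qed.

(** The coefficient of [x_j f_J] at [x^(a - e_(J - j))] is the one of [f_J] at
    [x^(a - e_J)] if [J] is in [Supp a]. If [J] is not but [J - j] is, then [j]
    is not in [Supp a], and [x_j] does not divide [x^(a - e_(J - j))]: the
    coefficient is 0. *)
Lemma of_strand_bdry f : of_strand (bdry X f) = bdry one (of_strand f).
Proof.
apply/ffunP => I; rewrite ffunE !bdryE; case: ifP => IB; last first.
  rewrite big1 // => J _; rewrite big1 // => j /andP[jJ /eqP IE].
  rewrite ffunE ifF ?mulr0 //; apply: contraFF IB => JB.
  by rewrite IE (subset_trans (subD1set _ _)).
rewrite raddf_sum /=; apply: eq_bigr => J _; rewrite raddf_sum /=.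
apply: eq_bigr => j /andP[jJ /eqP IE]; rewrite ffunE mul1r.
rewrite -signr_odd -[in RHS]signr_odd; rewrite !mulr_sign.
have -> : (if J \subset B then (f J)@_(a - mesym1 J) else 0) =
    ('X_j * f J)@_(a - mesym1 I).
  rewrite mcoeffXM mnmBE mnmE IE setD11 subn0.
  have JB : (J \subset B) = (0 < a j)%N.
    by rewrite -(setD1K jJ) subUset sub1set -IE IB andbT inE.
  rewrite JB; case: ifP => // aj; congr (_@_ _).
  by rewrite (mesym1_setD1 jJ) submDA addmC.
by case: odd; rewrite ?mcoeffN.
Qed.

Lemma to_strand_homogeneous c : supported c ->
  koszul_homogeneous a (to_strand c).
Proof.
move=> cB J m; rewrite mcoeff_msupp ffunE mcoeffZ mcoeffX.
have [<-|_] := eqVneq (a - mesym1 J)%MM m; last by rewrite mulr0 eqxx.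
have [JB _|/cB->] := boolP (J \subset B); last by rewrite mul0r eqxx.
by rewrite submK // mesym1_le.
Qed.

Lemma to_strandK c : supported c -> of_strand (to_strand c) = c.
Proof.
move=> cB; apply/ffunP => J; rewrite !ffunE mcoeffZ mcoeffX eqxx mulr1.
by case: ifP => // /negbT/cB.
Qed.

Lemma of_strandK f : koszul_homogeneous a f -> to_strand (of_strand f) = f.
Proof.
move=> hf; apply/ffunP => J; rewrite !ffunE; apply/mpolyP => m.
rewrite mcoeffZ mcoeffX.
(* A monomial of [f J] can only be [x^(a - e_J)], and forces [J] to be in the
   support of [a]. *)
have [fm0|] := eqVneq (f J)@_m 0.
  rewrite fm0; case: eqP => [->|_]; last by rewrite mulr0.
  by rewrite fm0 if_same mul0r.
rewrite -mcoeff_msupp => /hf aE.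
have -> : (a - mesym1 J)%MM = m by rewrite -aE addmK.
by rewrite -mesym1_le -[X in (_ <= X)%MM]aE lem_addl eqxx mulr1.
Qed.

Variable i : nat.

Lemma chains_subset m (c : exterior k n) :
  c \in chains DeltaB m -> supported c.
Proof. by move=> /chainsP cP J JB; apply: cP; rewrite inE (negbTE JB) andbF. Qed.

Lemma to_strand_chains m c : c \in chains DeltaB m -> to_strand c \in chains Delta m.
Proof.
move=> /chainsP cP; apply/chainsP => J JP; rewrite ffunE cP ?scale0r //.
by apply: contra JP; rewrite inE -andbA => /and3P[-> _ ->].
Qed.

Lemma of_strand_chains m f : f \in chains Delta m -> of_strand f \in chains DeltaB m.
Proof.
move=> /chainsP fP; apply/chainsP => J JP; rewrite ffunE; case: ifP => // JB.
by rewrite fP ?mcoeff0 //; apply: contra JP; rewrite inE JB andbT.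
Qed.

Fact to_strand_cycle (z : cycles one DeltaB i) : to_strand z \in is_cycle X Delta i.
Proof.
case: z => z /= /andP[zi /eqP z0]; apply/andP; split; first exact: to_strand_chains.
rewrite -to_strand_bdry ?z0; last exact: (chains_subset zi).
by apply/eqP/ffunP => J; rewrite !ffunE scale0r.
Qed.

Fact of_strand_cycle (z : cycles X Delta i) : of_strand z \in is_cycle one DeltaB i.
Proof.
case: z => z /= /andP[zi /eqP z0]; apply/andP; split; first exact: of_strand_chains.
rewrite -of_strand_bdry z0.
by apply/eqP/ffunP => J; rewrite !ffunE mcoeff0 if_same.
Qed.

Definition to_strand_cycles (z : cycles one DeltaB i) : cycles X Delta i :=
  Cycle (to_strand_cycle z).

Lemma to_strandB c d : to_strand (c - d) = to_strand c - to_strand d.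
Proof. by apply/ffunP=> J; rewrite !ffunE scalerBl. Qed.

(** Each inclusion transports a chain with the given boundary, by [of_strand]
    or by [to_strand]. This gives at once that [to_strand] descends to homology
    and that it is injective there. *)
Lemma to_strand_boundaries (y z : cycles one DeltaB i) :
  (to_strand_cycles y - to_strand_cycles z \in @boundaries _ _ X Delta i) =
  (y - z \in @boundaries _ _ one DeltaB i).
Proof.
have supp_cycle (c : cycles one DeltaB i) : supported c.
  by case: c => c /= /andP[/chains_subset].
apply/asboolP/asboolP; rewrite !raddfB /= => -[f fi yzf].
  exists (of_strand f); first exact: of_strand_chains.
  rewrite -of_strand_bdry -yzf -to_strandB to_strandK // => J JB.
  by rewrite !ffunE !supp_cycle // subr0.
exists (to_strand f); first exact: to_strand_chains.
by rewrite -to_strand_bdry -?yzf ?to_strandB //; exact: chains_subset fi.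
Qed.

Definition strand_class (v : homology one DeltaB i) :
    restrict_scalars (koszul_module k Delta i) :=
  \pi_(lquot (@boundaries _ _ X Delta i)) (to_strand_cycles (repr v)).

Lemma strand_class_pi (z : cycles one DeltaB i) :
  strand_class (\pi_(lquot (@boundaries _ _ one DeltaB i)) z) =
  \pi_(lquot (@boundaries _ _ X Delta i)) (to_strand_cycles z).
Proof.
by apply/lquot_eq; rewrite to_strand_boundaries; apply/lquot_eq; rewrite reprK.
Qed.

Fact strand_class_is_linear : linear strand_class.
Proof.
move=> c u v; rewrite -[u]reprK -[v]reprK.
set Q := lquot (@boundaries _ _ one DeltaB i).
have -> : c *: \pi_Q (repr u) + \pi_Q (repr v) = \pi_Q (c *: repr u + repr v).
  by rewrite raddfD /=; congr (_ + _); exact: (esym (pi_lquot_scale _ _ _)).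
rewrite !strand_class_pi.
have -> : to_strand_cycles (c *: repr u + repr v) =
  (c%:A : S) *: to_strand_cycles (repr u) + to_strand_cycles (repr v).
  by apply: val_inj; rewrite /= to_strand_is_linear.
by rewrite raddfD /=; congr (_ + _); exact: pi_lquot_scale.
Qed.
HB.instance Definition _ :=
  GRing.isLinear.Build k _ _ _ strand_class strand_class_is_linear.

Lemma strand_class_inj : injective strand_class.
Proof.
move=> u v; rewrite -[u]reprK -[v]reprK !strand_class_pi => /lquot_eq.
by rewrite to_strand_boundaries => /lquot_eq.
Qed.

Lemma koszul_pieceE (w : restrict_scalars (koszul_module k Delta i)) :
  koszul_piece a w <-> exists2 v, True & w = strand_class v.
Proof.
split=> [[z za ->]|[v _ ->]].
  exists (\pi_(lquot (@boundaries _ _ one DeltaB i)) (Cycle (of_strand_cycle z))) => //.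
  rewrite strand_class_pi; congr \pi; apply: val_inj => /=.
  by rewrite of_strandK.
exists (to_strand_cycles (repr v)) => //=; apply: to_strand_homogeneous.
by case: (repr v) => c /= /andP[/chains_subset].
Qed.

End Strand.

Lemma dimk_koszul_piece (k : fieldType) n (Delta : {set {set 'I_n}}) i a :
  dimk (@koszul_piece k n Delta i a) =
  dimk (fun _ : homology (fun _ => 1 : k) (restrict_complex Delta (Supp a)) i => True).
Proof.
exact/esym/(dimk_inj_image (@strand_class_inj k n Delta a i))/koszul_pieceE.
Qed.

(** * The Hilbert series *)

(* A square-free multi-index has degree at most [n], hence the index type
   of the right-hand side. *)
Theorem theorem1p2 (k : fieldType) (char0 : [pchar k] =i pred0)
    (n : nat) (Delta : {set {set 'I_n}}) (HDelta : simplicial_complex Delta)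
    (i : nat) (i_gt0 : (0 < i)%N) :
  koszul_hilbert_series k Delta i =
  \sum_(b : 'X_{1..n < n.+1} | squarefree b)
    (dimk (fun _ : reduced_homology k i.-1 (restrict_complex Delta (Supp b)) => True))%:R
    * (tmon int b / \prod_(j in Supp b) (1 - tvar int j)).
Proof.
case: i i_gt0 => // i _; apply: fpsP => a.
rewrite (fcoef_sum_squarefree _ (fun B : {set 'I_n} =>
  dimk (fun _ : reduced_homology k i (restrict_complex Delta B) => True))) /=.
by rewrite dimk_koszul_piece.
Qed.
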